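(* Let $\alpha=12\cdots c$ and $\hat\alpha=c(c-1)\cdots1$. The partition $\{S_c\}$ (with the single part $S_c$) is $\{\alpha,\hat\alpha\}$-confluent; that is, the $(\{S_c\},\{\alpha,\hat\alpha\})$-straightening operator on $S_n$ is confluent.
   Context: Fix positive integers $c\le n$. $S_m$ is the set of permutations of $\{1,\dots,m\}$ written as words. A word $w_1\cdots w_c$ (distinct integer letters) forms $u\in S_c$ if there is an integer $k$ with $w_i=u_i+k$ for all $i$. An $S_c$-hit in $w\in S_n$ is a contiguous subword of length $c$ forming some $u\in S_c$; an $S_c$-rearrangement rearranges the letters of an $S_c$-hit arbitrarily in place. The $S_c$-equivalence is the reflexive-transitive closure of $S_c$-rearrangement on $S_n$. Tail size of a word $w$ of length $m$ with distinct letters: least $k\ge1$ such that the first $k$ letters are the $k$ smallest letters of $w$. $w$ is right leaning if its tail size is $<m$, left leaning if its reversal has tail size $<m$, omni leaning if neither. Polarization of a hit $h$ in $w\in S_n$: if $h$ is all of $w$, $h$ is left polarized. Otherwise let $a$ be the average of the letters of $h$, $w'$ be $w$ with $h$ replaced by the single letter $a$, and $b$ the letter adjacent to $a$ in $w'$ closest in value to $a$ (ties: the left one). If $a,b$ appear in increasing order in $w'$, $h$ is right polarized; if decreasing, left polarized. A hit is backward if it is right polarized and left leaning, or left polarized and right leaning, or omni leaning; otherwise forward. An $S_c$-hit $h$ is $(S_c,\{\alpha,\hat\alpha\})$-straightened if it forms $\alpha$ or $\hat\alpha$ and either it is forward, or it is backward and no rearrangement of $h$ makes it forward. $(S_c,\{\alpha,\hat\alpha\})$-straightening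 a hit means rearranging it in place so it becomes straightened. The straightening operator $\to$ on $S_n$: $w\to w'$ iff $w'$ is obtained from $w$ by straightening an $S_c$-hit of $w$ that was not straightened. A relation $\to$ on a finite set $A$ with reflexive-transitive closure $\to'$ is confluent if there are no distinct $a,b$ with $a\to'b$ and $b\to'a$, and each connected component $K$ of $(A,\to)$ has a unique node $m$ with $x\to'm$ for all $x\in K$. *)

(* Defs.v *)
From Stdlib Require Export Relation_Operators.
From mathcomp Require Export all_boot all_order all_fingroup all_algebra.

Set Implicit Arguments.
Unset Strict Implicit.
Unset Printing Implicit Defensive.

Import Order.TTheory GRing.Theory Num.Theory.

Local Open Scope nat_scope.

Section Confluence.

Variables (A : finType) (r : A -> A -> Prop).

(* r is directed; connected components are those of the underlying
   undirected graph. *)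
Definition component (x y : A) : Prop := clos_refl_sym_trans A r x y.

Definition reaches (x y : A) : Prop := clos_refl_trans A r x y.

Definition confluent : Prop :=
  (~ exists a b, [/\ a <> b, reaches a b & reaches b a]) /\
  (forall x0, exists! m,
     component x0 m /\ forall x, component x0 x -> reaches x m).

End Confluence.

(* A permutation of 'I_m, seen as a word on the letters 1, ..., m. *)
Definition word m (u : 'S_m) : seq nat := [seq (u i).+1 | i <- enum 'I_m].

Definition forms c (h : seq nat) (u : 'S_c) : Prop :=
  exists k : int, ([seq x%:Z | x <- h] = [seq x%:Z + k | x <- word u])%R.

Definition ascending c : 'S_c := 1%g.

(* The word c (c-1) ... 1. *)
Definition descending c : 'S_c := perm (@rev_ord_inj c).

Definition starts_with_smallest (w : seq nat) (k : nat) : bool :=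
  perm_eq (take k w) (take k (sort leq w)).

Lemma tail_exists (w : seq nat) :
  exists k, (0 < k) && starts_with_smallest w k.
Proof.
exists (size w).+1; rewrite /starts_with_smallest.
by rewrite !take_oversize ?size_sort ?leqnSn // perm_sym perm_sort perm_refl.
Qed.

Definition tail_size (w : seq nat) : nat := ex_minn (tail_exists w).

Definition right_leaning (w : seq nat) : bool := tail_size w < size w.

Definition left_leaning (w : seq nat) : bool := tail_size (rev w) < size w.

Definition omni_leaning (w : seq nat) : bool :=
  ~~ right_leaning w && ~~ left_leaning w.

(* From here on, a hit h of a word w is given together with its position, by
   a decomposition w = p ++ h ++ s. *)

Definition average (h : seq nat) : rat :=
  ((\sum_(x <- h) x%:R) / (size h)%:R)%R.

(* The letters a and b, in the order in which they occur in the word w' which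
   is p ++ h ++ s with h collapsed to its average a; here b is the neighbour of
   a closest in value, the left one in case of a tie. There is no such pair
   when h is the whole word. *)
Definition collapsed_pair (p h s : seq nat) : option (rat * rat) :=
  let a := average h in
  match ohead (rev p), ohead s with
  | None, None => None
  | Some l, None => Some (l%:R, a)
  | None, Some t => Some (a, t%:R)
  | Some l, Some t =>
      if `|l%:R - a| <= `|t%:R - a| then Some (l%:R, a) else Some (a, t%:R)
  end%R.

Definition right_polarized (p h s : seq nat) : bool :=
  if collapsed_pair p h s is Some (x, y) then (x < y)%R else false.

Definition left_polarized (p h s : seq nat) : bool :=
  if collapsed_pair p h s is Some (x, y) then (y < x)%R else true.

Definition backward (p h s : seq nat) : bool :=
  [|| right_polarized p h s && left_leaning h,
      left_polarized p h s && right_leaning h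
    | omni_leaning h].

Definition forward (p h s : seq nat) : bool := ~~ backward p h s.

Section Straightening.

Variables (c : nat) (alpha beta : 'S_c).

Definition is_hit (h : seq nat) : Prop := exists u : 'S_c, forms h u.

Definition straightened (p h s : seq nat) : Prop :=
  (forms h alpha \/ forms h beta) /\
  (forward p h s \/
   (backward p h s /\ ~ exists h', perm_eq h h' /\ forward p h' s)).

Definition straightening n (w w' : 'S_n) : Prop :=
  exists p h h' s : seq nat,
    [/\ word w = p ++ h ++ s, is_hit h, ~ straightened p h s,
        word w' = p ++ h' ++ s
      & perm_eq h h' /\ straightened p h' s].

End Straightening.

(* Main.v *)
Require Import Defs.
From Stdlib Require Import Operators_Properties.
From mathcomp Require Import zify.

(** Straightening the hit with smallest letter m at position i sorts it
    increasingly or decreasingly according to its polarization, which depends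
    only on the letters next to it. Two hits of a word overlap in as many
    positions as letters. If they overlap properly, both are polarized in the
    direction in which their letters move, so sorting one keeps the other a hit
    and both sort the overlap in the same way. If they are disjoint, sorting one
    can change the neighbour of the other only within an interval of values that
    lies on one side of it and contains no other neighbour, so polarizations
    persist. Hence straightenings at different hits commute and preserve each
    other's hits: the number of straightened hits increases at each step, and
    the one-step relation has the diamond property. *)

Set Implicit Arguments.
Unset Strict Implicit.
Unset Printing Implicit Defensive.

Import Order.TTheory GRing.Theory Num.Theory.

Local Open Scope nat_scope.

(** * Confluence from commuting idempotent partial maps *)

Section CommutingActions.

Variables (A I : finType) (r : A -> A -> Prop).
Variables (ok : I -> A -> bool) (act : I -> A -> A).

Hypothesis ok_act : forall i j x, ok i x -> ok j x -> ok i (act j x).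
Hypothesis act_comm :
  forall i j x, ok i x -> ok j x -> act i (act j x) = act j (act i x).
Hypothesis act_idem : forall i x, ok i x -> act i (act i x) = act i x.
Hypothesis rE :
  forall x y, r x y <-> exists i, [/\ ok i x, y = act i x & y <> x].

(** A potential bounded by [#|I|]: its growth along [r] rules out cycles and forces termination. *)
Let settled x := #|[set i | ok i x & act i x == x]|.

(** If [act j] fixes [x], commutation makes it fix [act i x] as well; idempotence settles [i] in
    addition. *)
Lemma settled_step x y : r x y -> settled x < settled y.
Proof.
case/rE=> i [okx -> neq]; apply/proper_card/properP; split.
  apply/subsetP => j; rewrite !inE => /andP[okj /eqP fixj].
  by rewrite ok_act //= act_comm // fixj.
exists i; rewrite !inE; first by rewrite ok_act //= act_idem.
by rewrite okx /=; apply/eqP.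
Qed.

Lemma settled_reaches x y : reaches r x y -> x = y \/ settled x < settled y.
Proof.
elim=> [a b /settled_step|a|a b d _ [->|ab] _ [<-|bd]]; auto.
by right; apply: ltn_trans bd.
Qed.

(** The branches meet at [act i (act j x)]; either leg may be trivial, hence the equalities. *)
Lemma diamond x y z : r x y -> r x z ->
  exists t, (y = t \/ r y t) /\ (z = t \/ r z t).
Proof.
case/rE=> i [oki -> _] /rE[j [okj -> _]].
exists (act i (act j x)); split.
  case: (eqVneq (act i x) (act i (act j x))) => [|/eqP neq]; first by left.
  right; apply/rE; exists j; split; first exact: ok_act.
    exact: act_comm.
  exact/nesym.
case: (eqVneq (act j x) (act i (act j x))) => [|/eqP neq]; first by left.
right; apply/rE; exists i; split=> //; first exact: ok_act.
exact/nesym.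
Qed.

(** The diamond closes with at most one step on each side, so a single step can be pushed along a
    whole path. *)
Lemma strip x y z : reaches r x z -> x = y \/ r x y ->
  exists t, reaches r y t /\ (z = t \/ r z t).
Proof.
move=> /(@clos_rt_rt1n A r) xz; elim: {x z} xz y => [x|x x' z xx' x'z IH] y xy.
  by exists y; split=> //; apply: rt_refl.
case: xy => [<-|xy].
  exists z; split; last by left.
  by apply: rt_trans (rt_step _ _ _ _ xx') (clos_rt1n_rt _ _ _ _ x'z).
have [t [x't yt]] := diamond xx' xy.
have [u [tu zu]] := IH t x't.
exists u; split=> //; case: yt => [->//|yt].
exact: rt_trans (rt_step _ _ _ _ yt) tu.
Qed.

Lemma normal_form x : exists m, reaches r x m /\ forall y, ~ r m y.
Proof.
move: {2}(#|I| - settled x).+1 (ltnSn (#|I| - settled x)) => b.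
elim: b x => // b IH x ltb.
have [/existsP[i /andP[oki /eqP neq]]|none] :=
    boolP [exists i, ok i x && (act i x != x)].
  have xy : r x (act i x) by apply/rE; exists i.
  have lt := settled_step xy.
  have le : settled (act i x) <= #|I| by apply: max_card.
  have [|m [ym nm]] := IH (act i x); first by lia.
  by exists m; split=> //; apply: rt_trans (rt_step _ _ _ _ xy) ym.
exists x; split=> [|y /rE[i [oki -> neq]]]; first exact: rt_refl.
by case/negP: none; apply/existsP; exists i; rewrite oki; apply/eqP.
Qed.

Lemma commuting_confluent : confluent r.
Proof.
split=> [[a [b [neq ab ba]]]|x0].
  case: (settled_reaches ab) (settled_reaches ba) => [//|lt] [/esym//|gt].
  by have := ltn_trans lt gt; rewrite ltnn.
have [m [x0m nm]] := normal_form x0.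
(* No step leaves [m], so [strip] closes at [m] itself. Reaching [m] is thus invariant under steps
   in both directions, hence constant on the component. *)
have step x y : r x y -> reaches r x m <-> reaches r y m.
  move=> xy; split=> [xm|ym]; last exact: rt_trans (rt_step _ _ _ _ xy) ym.
  have [t [yt [->//|mt]]] := strip xm (or_intror xy).
  by case: (nm t).
have comp x y : component r x y -> reaches r x m <-> reaches r y m.
  by elim=> // {x y} [x y _ []|x y z _ [? ?] _ [? ?]]; split; auto.
exists m; split.
  split=> [|x /comp[xm _]]; last exact: xm.
  by apply: clos_rt_clos_rst.
move=> m' [_ /(_ m (@clos_rt_clos_rst _ _ _ _ x0m))/(@clos_rt_rt1n A r) mm'].
by case: mm' nm => [|y z my _] // /(_ y).
Qed.

End CommutingActions.

(** * Hits and their sorting in words *)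

Lemma count_iota_interval a b m c :
  count (fun v => a <= v < b) (iota m c) = minn b (m + c) - maxn a m.
Proof.
elim: c m => [|c IH] m /=; first by lia.
by rewrite IH; case: (boolP (a <= m < b)); lia.
Qed.

Section Words.

Variable c : nat.
Hypothesis c_gt0 : 0 < c.

(* The hit of w at position i (from 0) whose smallest letter is m. *)
Definition hit (w : seq nat) i m :=
  (i + c <= size w) && perm_eq (take c (drop i w)) (iota m c).

(* Right polarization of a hit with smallest letter m between p and s: its
   neighbours lie outside [m, m + c), so on either side of the average they
   compare with it as with m, and the closest one is found without computing
   the average when both are on the same side. *)
Definition rising (p s : seq nat) m : bool :=
  match ohead (rev p), ohead s with
  | None, None => false
  | Some l, None => l < m
  | None, Some t => m < t
  | Some l, Some t => if (l < m) == (t < m) then t < l else l < m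
  end.

Definition run (up : bool) m := if up then iota m c else rev (iota m c).

Definition straighten (w : seq nat) i m :=
  take i w ++ run (rising (take i w) (drop (i + c) w) m) m ++ drop (i + c) w.

Lemma run_perm up m : perm_eq (run up m) (iota m c).
Proof. by case: up; rewrite /run // perm_rev. Qed.

Lemma size_run up m : size (run up m) = c.
Proof. by rewrite (perm_size (run_perm up m)) size_iota. Qed.

Lemma nth_run up m x : x < c ->
  nth 0 (run up m) x = if up then m + x else m + (c - x.+1).
Proof.
move=> ltx; case: up; rewrite /run ?nth_rev ?size_iota // nth_iota //; lia.
Qed.

(** [rising] read off by positions, which turns polarization into arithmetic on [nth]. The guards
    shield [i.-1] at [i = 0] and the default letter past the end. *)
Definition rising_at (w : seq nat) i m : bool :=
  let l := nth 0 w i.-1 in let t := nth 0 w (i + c) in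
  if 0 < i then
    if i + c < size w then (if (l < m) == (t < m) then t < l else l < m)
    else l < m
  else (i + c < size w) && (m < t).

Lemma risingE w i m : i + c <= size w ->
  rising (take i w) (drop (i + c) w) m = rising_at w i m.
Proof.
rewrite /rising /rising_at => le.
have -> : ohead (rev (take i w)) = if 0 < i then Some (nth 0 w i.-1) else None.
  case: i le => [|i] le; first by rewrite take0.
  by rewrite (take_nth 0) ?rev_rcons //; lia.
have -> : ohead (drop (i + c) w) =
    if i + c < size w then Some (nth 0 w (i + c)) else None.
  by case: ltnP => lt; [rewrite (drop_nth 0)|rewrite drop_oversize].
by case: ifP => _; case: ifP.
Qed.

Section Hit.

Variables (w : seq nat) (i m : nat).
Hypothesis hw : hit w i m.

Lemma hit_le : i + c <= size w. Proof. by case/andP: hw. Qed.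

Lemma hit_perm : perm_eq w (take i w ++ iota m c ++ drop (i + c) w).
Proof.
rewrite -{1}(cat_take_drop i w) perm_cat2l -{1}(cat_take_drop c (drop i w)).
by rewrite drop_drop addnC perm_cat2r; case/andP: hw.
Qed.

(** The window uses up all values of [[m, m + c)]; as letters are distinct, none of them occurs
    elsewhere. *)
Lemma hit_nth x : uniq w -> x < size w ->
  (m <= nth 0 w x < m + c) = (i <= x < i + c).
Proof.
have [le pm] := andP hw; have le' := hit_le => Uw ltx.
rewrite -mem_iota -(perm_mem pm).
have wE : w = take i w ++ take c (drop i w) ++ drop (i + c) w.
  by rewrite addnC -drop_drop !cat_take_drop.
have si : size (take i w) = i by rewrite size_takel //; lia.
have sc : size (take c (drop i w)) = c by rewrite size_takel // size_drop; lia.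
have := Uw; rewrite {1}wE !cat_uniq has_cat negb_or.
case/and3P=> [_ /andP[/hasPn h1 _]].
case/and3P=> _ /hasPn h2 _.
rewrite {1}wE !nth_cat si sc; case: ltnP => lix /=.
  by apply/negP => /h1; rewrite /= mem_nth // si.
case: ltnP => ltc.
  by rewrite mem_nth ?sc //; lia.
have -> : x < i + c = false by lia.
have lt2 : x - i - c < size w - (i + c) by lia.
by apply/negbTE/h2/mem_nth; rewrite size_drop.
Qed.

Lemma straighten_perm : perm_eq (straighten w i m) w.
Proof.
rewrite perm_sym; apply: perm_trans hit_perm _.
by rewrite perm_cat2l perm_cat2r perm_sym run_perm.
Qed.

Lemma straighten_uniq : uniq w -> uniq (straighten w i m).
Proof. by rewrite (perm_uniq straighten_perm). Qed.

Lemma size_straighten : size (straighten w i m) = size w.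
Proof. exact: perm_size straighten_perm. Qed.

Lemma nth_straighten x : nth 0 (straighten w i m) x =
  if i <= x < i + c then
    if rising_at w i m then m + (x - i) else m + (c - (x - i).+1)
  else nth 0 w x.
Proof.
have le := hit_le; rewrite /straighten risingE // !nth_cat size_run.
rewrite size_takel; last by lia.
case: (ltnP x i) => /= lx; first by rewrite nth_take.
have -> : (x - i < c) = (x < i + c) by lia.
case: ifP => lc; first by rewrite nth_run //; lia.
by rewrite nth_drop; congr nth; lia.
Qed.

Lemma hit_straighten_self : hit (straighten w i m) i m.
Proof.
rewrite /hit size_straighten hit_le /= /straighten drop_cat.
have le := hit_le.
rewrite size_takel; last by lia.
rewrite ltnn subnn drop0 take_cat size_run ltnn subnn take0 cats0.
exact: run_perm.
Qed.

End Hit.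

(** * Two hits in one word *)

(* Both sides, truncated at 0, count the letters common to the two hits: by
   value and by position. *)
Lemma hit_dist (w : seq nat) i m j k : uniq w -> hit w i m -> hit w j k ->
  minn k m + c - maxn k m = minn i j + c - maxn i j.
Proof.
move=> Uw hi hj; have [le pm] := andP hi; have lej := hit_le hj.
have /seq.permP/(_ (fun v => k <= v < k + c)) := pm.
rewrite count_iota_interval.
have -> : take c (drop i w) = [seq nth 0 w x | x <- iota i c].
  apply: (@eq_from_nth _ 0).
    by rewrite size_map size_iota size_takel // size_drop; lia.
  move=> x; rewrite size_takel ?size_drop; last by lia.
  move=> ltx; rewrite nth_take // nth_drop (nth_map 0) ?size_iota //.
  by rewrite nth_iota.
rewrite count_map (@eq_in_count _ _ (fun x => j <= x < j + c)); last first.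
  by move=> x; rewrite mem_iota /= => ltx; rewrite (hit_nth hj) //; lia.
by rewrite count_iota_interval; lia.
Qed.

(** On the side of the overlap, the neighbour of each hit is a letter of the other. The values of
    both hits together form an interval, so the opposite neighbour either lies on the other side in
    value or is farther away; both cases give the direction of the shift. *)
Lemma rising_at_overlap (w : seq nat) i m j k :
  uniq w -> hit w i m -> hit w j k ->
  i < j < i + c -> rising_at w i m = (m < k) /\ rising_at w j k = (m < k).
Proof.
move=> Uw hi hj ij; have D := hit_dist Uw hi hj.
have lei := hit_le hi; have lej := hit_le hj.
split; rewrite /rising_at.
  have := hit_nth hi Uw (x := i.-1); have := hit_nth hj Uw (x := i.-1).
  have := hit_nth hi Uw (x := i + c); have := hit_nth hj Uw (x := i + c).
  move: (nth 0 w i.-1) (nth 0 w (i + c)) => l t.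
  by repeat (case: ifP => ?); lia.
have := hit_nth hi Uw (x := j.-1); have := hit_nth hj Uw (x := j.-1).
have := hit_nth hi Uw (x := j + c); have := hit_nth hj Uw (x := j + c).
move: (nth 0 w j.-1) (nth 0 w (j + c)) => l t.
by repeat (case: ifP => ?); lia.
Qed.

(** [c] distinct letters in an interval of [c] values exhaust it. *)
Lemma hit_of_nth (w : seq nat) i m : uniq w -> i + c <= size w ->
  (forall x, i <= x < i + c -> m <= nth 0 w x < m + c) -> hit w i m.
Proof.
move=> Uw le bnd; rewrite /hit le /=.
have sc : size (take c (drop i w)) = c by rewrite size_takel // size_drop; lia.
have U : uniq (take c (drop i w)) by rewrite take_uniq // drop_uniq.
rewrite uniq_perm ?iota_uniq //.
have sub : {subset take c (drop i w) <= iota m c}.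
  move=> v /(nthP 0)[x]; rewrite sc => ltx <-.
  by rewrite mem_iota nth_take // nth_drop; apply: bnd; lia.
by have [] := uniq_min_size U sub; rewrite ?size_iota ?sc.
Qed.

(** If the hits overlap properly, sorting one in the direction of the shift puts the shared values
    back into the shared positions. *)
Lemma hit_straighten (w : seq nat) i m j k : uniq w -> hit w i m -> hit w j k ->
  hit (straighten w j k) i m.
Proof.
move=> Uw hi hj; have D := hit_dist Uw hi hj.
have lei := hit_le hi; have lej := hit_le hj.
apply: hit_of_nth; rewrite ?straighten_uniq ?size_straighten // => x inx.
have := hit_nth hi Uw (x := x); rewrite nth_straighten //.
case: ifP => inx'; last by lia.
move=> _; case: (ltngtP i j) => [lt|lt|eq]; last by case: ifP; lia.
  by have [|_ ->] := rising_at_overlap Uw hi hj; [lia|case: ifP; lia].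
by have [|-> _] := rising_at_overlap Uw hj hi; [lia|case: ifP; lia].
Qed.

Lemma rising_at_straighten (w : seq nat) i m j k :
  uniq w -> hit w i m -> hit w j k ->
  rising_at (straighten w j k) i m = rising_at w i m.
Proof.
move=> Uw hi hj; have D := hit_dist Uw hi hj.
have lei := hit_le hi; have lej := hit_le hj.
have hi' := hit_straighten Uw hi hj; have hj' := hit_straighten_self hj.
have Uw' := straighten_uniq hj Uw; have sw' := size_straighten hj.
(* Under proper overlap the order of [m] and [k] decides the polarization, both before and after,
   since both hits persist. *)
have [/andP[ij ji]|noij] := boolP (i < j < i + c).
  have [|-> _] := rising_at_overlap Uw hi hj; first by rewrite ij.
  by have [|-> _] := rising_at_overlap Uw' hi' hj'; first by rewrite ij.
have [/andP[ji ij]|noji] := boolP (j < i < j + c).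
  have [|_ ->] := rising_at_overlap Uw hj hi; first by rewrite ji.
  by have [|_ ->] := rising_at_overlap Uw' hj' hi'; first by rewrite ji.
have E x : j <= x < j + c = false -> nth 0 (straighten w j k) x = nth 0 w x.
  by move=> out; rewrite nth_straighten // out.
rewrite /rising_at sw'.
have [eij|neq] := eqVneq i j.
  rewrite (E (i + c)); last by clear -eij; lia.
  by case: ifP => // i_gt0; rewrite E //; clear -eij i_gt0; lia.
(* No shared position, so by [D] no shared value. *)
have mk : m + c <= k \/ k + c <= m by clear -D neq noij noji; lia.
(* The hit at [i] directly follows the one at [j]: its left neighbour may change, but stays in
   [[k, k + c)], which lies on one side of [m] and misses the right neighbour. *)
have [adj|nadjl] := eqVneq i (j + c).
  rewrite [nth 0 (straighten w j k) (i + c)]E; last by clear -adj; lia.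
  have [i_gt0 ltl] : 0 < i /\ i.-1 < size w by clear -adj lei c_gt0; lia.
  have lval : k <= nth 0 w i.-1 < k + c.
    by rewrite (hit_nth hj Uw) //; clear -adj c_gt0; lia.
  have lval' : k <= nth 0 (straighten w j k) i.-1 < k + c.
    by rewrite (hit_nth hj' Uw') ?sw' //; clear -adj c_gt0; lia.
  have tval : i + c < size w -> k <= nth 0 w (i + c) < k + c = false.
    by move=> lt; rewrite (hit_nth hj Uw) //; clear -adj; lia.
  rewrite i_gt0; move: tval lval lval' mk; clear.
  move: (nth 0 w i.-1) (nth 0 w (i + c)) (nth 0 _ i.-1) => l t l'.
  by case: ifP => [_ /(_ isT)|_ _]; repeat (case: ifP => ?); lia.
rewrite [nth 0 (straighten w j k) i.-1]E; last first.
  by clear -nadjl neq noij noji c_gt0; lia.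
(* The mirror case: only the right neighbour may change. *)
have [adj|nadjr] := eqVneq j (i + c); last first.
  by rewrite E //; clear -nadjr neq noij noji c_gt0; lia.
have ltt : i + c < size w by clear -adj lej c_gt0; lia.
have tval : k <= nth 0 w (i + c) < k + c.
  by rewrite (hit_nth hj Uw) //; clear -adj c_gt0; lia.
have tval' : k <= nth 0 (straighten w j k) (i + c) < k + c.
  by rewrite (hit_nth hj' Uw') ?sw' //; clear -adj c_gt0; lia.
have lval : 0 < i -> k <= nth 0 w i.-1 < k + c = false.
  by move=> lt; rewrite (hit_nth hj Uw) //; clear -adj lt lej c_gt0; lia.
rewrite ltt; move: tval tval' lval mk; clear.
move: (nth 0 w i.-1) (nth 0 w (i + c)) (nth 0 _ (i + c)) => l t t'.
by case: ifP => [_ ? ? /(_ isT)|_ ? ? _] /=; repeat (case: ifP => ?); lia.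
Qed.

(** Polarizations persist, so the two orders could differ only at shared positions. There both hits
    are sorted in the same direction, and the shift in values matches the shift in positions. *)
Lemma straighten_comm (w : seq nat) i m j k :
  uniq w -> hit w i m -> hit w j k ->
  straighten (straighten w j k) i m = straighten (straighten w i m) j k.
Proof.
wlog le : i m j k / i <= j.
  by move=> W Uw hi hj; case: (leqP i j) => [|/ltnW] le; [|symmetry]; apply: W.
move=> Uw hi hj; have D := hit_dist Uw hi hj.
have hi' := hit_straighten Uw hi hj; have hj' := hit_straighten Uw hj hi.
apply: (@eq_from_nth _ 0); first by rewrite !size_straighten.
move=> x _; rewrite !nth_straighten // !rising_at_straighten //.
have := rising_at_overlap Uw hi hj.
case: (eqVneq i j) => [eij|neq].
  have -> : k = m by lia.
  by rewrite eij.
case: (ltnP j (i + c)) => lt; last by move=> _; repeat (case: ifP => ?); lia.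
case=> [|-> ->]; first by lia.
by repeat (case: ifP => ?); lia.
Qed.

Lemma straighten_idem (w : seq nat) i m : uniq w -> hit w i m ->
  straighten (straighten w i m) i m = straighten w i m.
Proof.
move=> Uw hi; have hi' := hit_straighten_self hi.
apply: (@eq_from_nth _ 0); first by rewrite !size_straighten.
move=> x _; rewrite !nth_straighten // !rising_at_straighten //.
by repeat case: ifP.
Qed.

End Words.

(** * Permutations as words *)

Lemma iota_map m c : iota m c = [seq m + x | x <- iota 0 c].
Proof. by rewrite -iotaDl addn0. Qed.

Lemma word_perm m (u : 'S_m) : perm_eq (word u) (iota 1 m).
Proof.
have -> : iota 1 m = [seq (val i).+1 | i <- enum 'I_m].
  by rewrite iota_map -val_enum_ord -map_comp; apply: eq_map.
have -> : word u = [seq (val i).+1 | i <- [seq u i | i <- enum 'I_m]].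
  by rewrite -map_comp.
apply: perm_map; apply: uniq_perm; rewrite ?enum_uniq //.
  by rewrite map_inj_uniq ?enum_uniq //; apply: perm_inj.
move=> i; rewrite mem_enum inE; apply/mapP.
by exists ((u^-1)%g i); rewrite ?permKV // mem_enum.
Qed.

Lemma word_uniq m (u : 'S_m) : uniq (word u).
Proof. by rewrite (perm_uniq (word_perm u)) iota_uniq. Qed.

Lemma size_word m (u : 'S_m) : size (word u) = m.
Proof. by rewrite (perm_size (word_perm u)) size_iota. Qed.

Lemma nth_word m (u : 'S_m) (i : 'I_m) : nth 0 (word u) i = (u i).+1.
Proof. by rewrite (nth_map i) ?size_enum_ord // nth_ord_enum. Qed.

Lemma word_inj m : injective (@word m).
Proof.
move=> u v e; apply/permP => i; apply/val_inj/succn_inj.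
by rewrite -!nth_word e.
Qed.

Lemma word_surj m v : perm_eq v (iota 1 m) -> exists u : 'S_m, word u = v.
Proof.
move=> pv; have sv : size v = m by rewrite (perm_size pv) size_iota.
have Uv : uniq v by rewrite (perm_uniq pv) iota_uniq.
have bnd (i : 'I_m) : 0 < nth 0 v i <= m.
  have : nth 0 v i \in iota 1 m by rewrite -(perm_mem pv) mem_nth ?sv.
  by rewrite mem_iota; lia.
have lt (i : 'I_m) : (nth 0 v i).-1 < m by have := bnd i; lia.
have inj : injective (fun i => Ordinal (lt i)).
  move=> i j [e]; apply/val_inj/eqP => /=.
  rewrite -(nth_uniq 0 _ _ Uv) ?sv //; apply/eqP.
  have [/andP[vi _] /andP[vj _]] := (bnd i, bnd j).
  by rewrite -(prednK vi) e prednK.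
exists (perm inj); apply: (@eq_from_nth _ 0); rewrite size_word // => x ltx.
have -> : x = Ordinal ltx by [].
by rewrite nth_word permE /= prednK //; case/andP: (bnd (Ordinal ltx)).
Qed.

Lemma word_ascending c : word (ascending c) = iota 1 c.
Proof.
apply: (@eq_from_nth _ 0); rewrite size_word ?size_iota // => x ltx.
by rewrite nth_iota // -[in LHS](erefl : val (Ordinal ltx) = x) nth_word perm1.
Qed.

Lemma word_descending c : word (descending c) = rev (iota 1 c).
Proof.
apply: (@eq_from_nth _ 0); rewrite size_word ?size_rev ?size_iota // => x ltx.
rewrite nth_rev ?size_iota // nth_iota; last by lia.
by rewrite -[in LHS](erefl : val (Ordinal ltx) = x) nth_word permE /=; lia.
Qed.

(** * Forms, leaning and polarization of hits *)

Section Hits.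

Variable c : nat.
Hypothesis c_gt0 : 0 < c.

Lemma is_hitP h : is_hit c h <-> exists m, perm_eq h (iota m c).
Proof.
split=> [[u [k e]]|[m pm]].
  (* The letter 1 of [word u] becomes [1 + k], a letter of [h], hence a natural number although [k]
     is an integer. *)
  have [y hy] : exists y : nat, (1 + k)%R = y.
    have : (Posz 1 + k)%R \in [seq Posz x | x <- h].
      rewrite e; apply: (map_f (fun x : nat => Posz x + k)%R).
      by rewrite (perm_mem (word_perm u)) mem_iota; lia.
    by case/mapP=> y _ ->; exists y.
  exists y; apply: (perm_map_inj (f := Posz)); first by move=> ? ? [].
  rewrite e; apply: perm_trans (perm_map _ (word_perm u)) _.
  rewrite (iota_map 1) (iota_map y) -!map_comp.
  by apply/seq.permP => P; congr count; apply: eq_map => x /=; lia.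
have mh x : x \in h -> m <= x by rewrite (perm_mem pm) mem_iota; lia.
have [|u hu] := @word_surj c [seq x.+1 - m | x <- h].
  apply: perm_trans (perm_map _ pm) _.
  rewrite (iota_map 1) (iota_map m) -!map_comp.
  by apply/seq.permP => P; congr count; apply: eq_map => x /=; lia.
exists u, (Posz m - 1)%R; rewrite hu -map_comp.
by apply/eq_in_map => x /mh /=; lia.
Qed.

Lemma forms_iota h u m : perm_eq h (iota m c) ->
  forms h u <-> h = [seq (x + m).-1 | x <- word (u : 'S_c)].
Proof.
move=> pm; split=> [[k e]|->]; last first.
  exists (Posz m - 1)%R; rewrite -map_comp; apply/eq_in_map => x.
  by rewrite (perm_mem (word_perm u)) mem_iota /=; lia.
(* The shift is forced by comparing the smallest letters [1 + k] and [m]. *)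
have ek : (k = Posz m - 1)%R.
  have : (Posz 1 + k)%R \in [seq Posz x | x <- h].
    rewrite e; apply: (map_f (fun x : nat => Posz x + k)%R).
    by rewrite (perm_mem (word_perm u)) mem_iota; lia.
  case/mapP=> y; rewrite (perm_mem pm) mem_iota => ym ey.
  have : Posz m \in [seq Posz x | x <- h].
    by apply: map_f; rewrite (perm_mem pm) mem_iota; lia.
  rewrite e => /mapP[z]; rewrite (perm_mem (word_perm u)) mem_iota; lia.
have: [seq Posz x | x <- h] =
    [seq Posz x | x <- [seq (x + m).-1 | x <- word u]].
  rewrite e -map_comp; apply/eq_in_map => x.
  by rewrite (perm_mem (word_perm u)) mem_iota /=; lia.
by apply: inj_map => ? ? [].
Qed.

Lemma forms_run h m : perm_eq h (iota m c) ->
  forms h (ascending c) \/ forms h (descending c) <->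
  exists up, h = run c up m.
Proof.
move=> pm; rewrite !(forms_iota _ pm) word_ascending word_descending map_rev.
have -> : [seq (x + m).-1 | x <- iota 1 c] = iota m c.
  rewrite (iota_map 1) (iota_map m) -!map_comp.
  by apply: eq_map => x /=; lia.
split=> [[]->|[[] ->]]; [by exists true|by exists false|by left|by right].
Qed.

Lemma tail_size_gt0 w : 0 < tail_size w.
Proof. by rewrite /tail_size; case: ex_minnP => k /andP[]. Qed.

Lemma tail_size_iota m : tail_size (iota m c) = 1.
Proof.
apply/eqP; rewrite eqn_leq tail_size_gt0 andbT /tail_size.
case: ex_minnP => k _; apply; rewrite /starts_with_smallest.
by rewrite (sorted_sort leq_trans) ?iota_sorted ?perm_refl.
Qed.

(** The word starts with its largest letter [m + c.-1], which is not among the [k] smallest for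
    [k < c]. *)
Lemma tail_size_rev_iota m : c <= tail_size (rev (iota m c)).
Proof.
rewrite /tail_size; case: ex_minnP => k /andP[k_gt0 sk] _.
rewrite leqNgt; apply/negP => ltk; move: sk; rewrite /starts_with_smallest.
have -> : sort leq (rev (iota m c)) = sort leq (iota m c).
  by apply/(perm_sortP leq_total leq_trans anti_leq); rewrite perm_rev.
rewrite (sorted_sort leq_trans) ?iota_sorted //.
rewrite take_iota => /perm_mem/(_ (m + c.-1)).
have -> : m + c.-1 = nth 0 (take k (rev (iota m c))) 0.
  by rewrite nth_take // nth_rev size_iota // nth_iota; lia.
rewrite mem_nth; last by rewrite size_take size_rev size_iota; case: ifP.
rewrite nth_take // nth_rev size_iota // nth_iota ?mem_iota; lia.
Qed.

(** These bounds suffice for comparing letters outside the hit with its average: such letters lie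
    below [m] or above [(m + c).-1]. *)
Lemma average_bounds h m : perm_eq h (iota m c) ->
  (m%:R <= average h <= (m + c).-1%:R)%R.
Proof.
move=> pm; rewrite /average (perm_size pm) size_iota (perm_big _ pm) /=.
have c0 : (0 < c%:R :> rat)%R by rewrite ltr0n.
have cst (a : nat) : (a%:R * c%:R = \sum_(x <- iota m c) a%:R :> rat)%R.
  by rewrite big_const_seq count_predT size_iota iter_addr_0 mulr_natr.
rewrite ler_pdivlMr // ler_pdivrMr // !cst !big_seq.
by apply/andP; split; apply: ler_sum => x; rewrite mem_iota ler_nat; lia.
Qed.

Lemma polarized_rising p h s m : uniq (p ++ h ++ s) -> perm_eq h (iota m c) ->
  right_polarized p h s = rising p s m /\
  left_polarized p h s = ~~ rising p s m.
Proof.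
move=> U pm; have /andP[a_ge a_le] := average_bounds pm.
rewrite /right_polarized /left_polarized /collapsed_pair /rising.
have lo x : x \notin h -> (x%:R < average h)%R = (x < m).
  rewrite (perm_mem pm) mem_iota => xh; case: ltnP => xm.
    by apply: lt_le_trans a_ge; rewrite ltr_nat.
  apply/negbTE; rewrite -leNgt; apply: le_trans a_le _; rewrite ler_nat; lia.
have hi x : x \notin h -> (average h < x%:R)%R = (m < x).
  rewrite (perm_mem pm) mem_iota => xh; case: ltnP => xm.
    by apply: le_lt_trans a_le _; rewrite ltr_nat; lia.
  by apply/negbTE; rewrite -leNgt; apply: le_trans a_ge; rewrite ler_nat.
have out x : x \notin h -> x != m.
  by apply: contraNneq => ->; rewrite (perm_mem pm) mem_iota; lia.
move: U; rewrite !cat_uniq has_cat negb_or.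
case/and3P=> _ /andP[/hasPn hp /hasPn sp] /and3P[_ /hasPn sh _].
have outl l : ohead (rev p) = Some l -> l \in p /\ l \notin h.
  rewrite -mem_rev; case E: (rev p) => [|l' r] //= [<-].
  rewrite mem_head; split=> //; apply/negP => /hp.
  by rewrite -(mem_rev p) E mem_head.
have outt t : ohead s = Some t -> t \notin p /\ t \notin h.
  by case: s sp sh => [|t' r] //= sp sh [<-]; rewrite sp ?sh ?mem_head.
case El: (ohead (rev p)) => [l|]; case Et: (ohead s) => [t|] //.
- have [lp lh] := outl _ El; have [tp th] := outt _ Et.
  have neq : l != t by apply: contraTneq lp => ->.
  have := out _ lh; have := out _ th.
  have := lo _ lh; have := hi _ lh; have := lo _ th; have := hi _ th.
  set a := average h; move=> hit lot hil lol nt nl.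
  (* With both neighbours on one side, the average cancels from the comparison of distances. *)
  have below : l < m -> t < m -> (`|l%:R - a| <= `|t%:R - a|)%R = (t <= l).
    move=> lm tm; rewrite !ltr0_norm ?subr_lt0 ?lol ?lot //.
    by rewrite lerN2 lerD2r ler_nat.
  have above : m < l -> m < t -> (`|l%:R - a| <= `|t%:R - a|)%R = (l <= t).
    move=> ml mt; rewrite !gtr0_norm ?subr_gt0 ?hil ?hit //.
    by rewrite lerD2r ler_nat.
  (* With neighbours on opposite sides, either choice of the closest one gives the same
     polarization. *)
  case: ifP below above => _; rewrite ?lol ?hil ?lot ?hit; clear -nt nl neq.
    by case: ifP; lia.
  by case: ifP; lia.
- have [lp lh] := outl _ El; rewrite lo // hi //; have := out _ lh; lia.
- have [tp th] := outt _ Et; rewrite lo // hi //; have := out _ th; lia.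
Qed.

(** For [c > 1] the increasing run leans only right and the decreasing one only left; neither is
    omni leaning. *)
Lemma forward_run p s m up : 1 < c -> uniq (p ++ iota m c ++ s) ->
  forward p (run c up m) s = (up == rising p s m).
Proof.
move=> c_gt1 U.
have U' : uniq (p ++ run c up m ++ s).
  rewrite (perm_uniq (s2 := p ++ iota m c ++ s)) //.
  by rewrite perm_cat2l perm_cat2r run_perm.
have [rp lp] := polarized_rising U' (run_perm c up m).
have lo := tail_size_iota m; have hi := tail_size_rev_iota m.
rewrite /forward /backward /omni_leaning /right_leaning /left_leaning.
rewrite rp lp size_run; case: up {U' rp lp};
  by rewrite /run ?revK lo c_gt1 [_ _ < c]ltnNge hi; case: rising.
Qed.

Lemma straightenedE p h s m : uniq (p ++ h ++ s) -> perm_eq h (iota m c) ->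
  straightened (ascending c) (descending c) p h s <->
  h = run c (rising p s m) m.
Proof.
move=> U pm; rewrite /straightened (forms_run pm).
(* For [c = 1] a hit is omni leaning, so always backward and beyond repair, while the two runs
   coincide. *)
have [c_gt1|c_le1] := ltnP 1 c; last first.
  have sz h' : perm_eq h h' -> backward p h' s.
    move=> ph; have sz : size h' = 1.
      by rewrite -(perm_size ph) (perm_size pm) size_iota; lia.
    rewrite /backward /omni_leaning /right_leaning /left_leaning sz.
    by rewrite !ltnS !leqn0 !eqn0Ngt !tail_size_gt0 !orbT.
  have hE up : h = run c up m.
    have : perm_eq h (run c up m).
      by rewrite perm_sym (perm_trans (run_perm _ _ _)) // perm_sym.
    have -> : c = 1 by lia.
    by case: up => /=; rewrite /run /= => /perm_small_eq ->.
  split=> // _; split; first by exists true.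
  right; split; first exact: sz.
  by case=> h' [/sz bh]; rewrite /forward bh.
have U' : uniq (p ++ iota m c ++ s).
  by rewrite (perm_uniq (s2 := p ++ h ++ s)) // perm_cat2l perm_cat2r perm_sym.
split=> [[[up ->]]|->].
  (* A backward run is never straightened: the run in the polarized direction is a forward
     rearrangement of it. *)
  rewrite forward_run // => -[/eqP->//|[_ []]].
  exists (run c (rising p s m) m); rewrite forward_run // eqxx.
  by rewrite (perm_trans (run_perm _ _ _)) // perm_sym run_perm.
split; first by exists (rising p s m).
by left; rewrite forward_run.
Qed.

End Hits.

(** * Straightening as commuting maps on permutations *)

Section Main.

Variables (c n : nat).
Hypothesis c_gt0 : 0 < c.

(** Letters run from 1 to [n], hence the index ['I_n.+1] for the smallest one. The default [w] is
    never met at a hit. *)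
Definition straighten_perm_at (im : 'I_n * 'I_n.+1) (w : 'S_n) : 'S_n :=
  odflt w [pick w' | word w' == straighten c (word w) im.1 im.2].

Lemma word_straighten_perm_at (im : 'I_n * 'I_n.+1) (w : 'S_n) :
  hit c (word w) im.1 im.2 ->
  word (straighten_perm_at im w) = straighten c (word w) im.1 im.2.
Proof.
move=> hw; rewrite /straighten_perm_at; case: pickP => [w' /eqP//|none].
have [|w' e] := @word_surj n (straighten c (word w) im.1 im.2).
  exact: perm_trans (straighten_perm hw) (word_perm w).
by have := none w'; rewrite e eqxx.
Qed.

Lemma straighteningE (w w' : 'S_n) :
  straightening (ascending c) (descending c) w w' <->
  exists im : 'I_n * 'I_n.+1,
    [/\ hit c (word w) im.1 im.2, w' = straighten_perm_at im w & w' <> w].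
Proof.
split=> [[p [h [h' [s [ew /(is_hitP c_gt0)[m pm] nst ew' [hh' st]]]]]]|].
  have sh : size h = c by rewrite (perm_size pm) size_iota.
  have pm' : perm_eq h' (iota m c) by apply: perm_trans pm; rewrite perm_sym.
  have U := word_uniq w; have U' := word_uniq w'.
  rewrite ew in U; rewrite ew' in U'.
  move/(straightenedE c_gt0 U' pm'): st => st.
  have sw := size_word w; rewrite ew !size_cat sh in sw.
  have lti : size p < n by lia.
  have ltm : m < n.+1.
    have : m \in word w by rewrite ew !mem_cat (perm_mem pm) mem_iota; lia.
    by rewrite (perm_mem (word_perm w)) mem_iota; lia.
  have tp : take (size p) (word w) = p by rewrite ew take_size_cat.
  have ds : drop (size p + c) (word w) = s.
    by rewrite ew addnC -drop_drop drop_size_cat // drop_size_cat.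
  have hw : hit c (word w) (size p) m.
    rewrite /hit size_word ew drop_size_cat // take_size_cat // pm.
    by rewrite andbT; lia.
  exists (Ordinal lti, Ordinal ltm); split=> //.
    apply: word_inj; rewrite word_straighten_perm_at //=.
    by rewrite /straighten tp ds ew' st.
  (* The straightened form is unique, so an unchanged word means that the hit was already
     straightened. *)
  move=> eww; apply: nst; move: ew'; rewrite eww ew.
  move/(congr1 (drop (size p))); rewrite !drop_size_cat //.
  move/(congr1 (take c)).
  rewrite !take_size_cat ?(perm_size pm') ?size_iota // => ehh.
  by apply/(straightenedE c_gt0 U pm); rewrite ehh.
case=> -[i m] /= [hw -> neq].
have ewi := word_straighten_perm_at (im := (i, m)) hw.
have lei := hit_le hw; have [_ pm] := andP hw.
set p := take i (word w); set s := drop (i + c) (word w).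
set h := take c (drop i (word w)).
have ew : word w = p ++ h ++ s by rewrite /s addnC -drop_drop !cat_take_drop.
have U := word_uniq w; rewrite ew in U.
have Ui := word_uniq (straighten_perm_at (i, m) w); rewrite ewi in Ui.
exists p, h, (run c (rising p s m) m), s; split=> //.
- by apply/(is_hitP c_gt0); exists m.
- move/(straightenedE c_gt0 U pm) => eh; apply: neq; apply: word_inj.
  by rewrite ewi {2}ew eh.
- split; first by rewrite (perm_trans pm) // perm_sym run_perm.
  by apply/(straightenedE c_gt0 Ui (run_perm c _ m)).
Qed.

End Main.

Theorem theorem4p3 (c n : nat) (c_gt0 : (0 < c)%N) (le_cn : (c <= n)%N) :
  confluent (@straightening c (ascending c) (descending c) n).
Proof.
pose ok (im : 'I_n * 'I_n.+1) (w : 'S_n) := hit c (word w) im.1 im.2.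
apply: (@commuting_confluent _ _ _ ok (@straighten_perm_at c n)).
- move=> im jk w hi hj; rewrite /ok word_straighten_perm_at //.
  by rewrite hit_straighten // word_uniq.
- move=> im jk w hi hj; have U := word_uniq w; apply: word_inj.
  rewrite !word_straighten_perm_at // ?hit_straighten //.
  exact: straighten_comm.
- move=> im w hi; have U := word_uniq w; apply: word_inj.
  rewrite !word_straighten_perm_at // ?hit_straighten //.
  exact: straighten_idem.
- exact: straighteningE.
Qed.
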